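(* Let $D_p, D_r, \lambda, A_p, A_r, h_1, h_2 > 0$, $0<p<1$ and $0<r\le 1$ be real numbers with $\lambda > D_r > rpD_p$, and let $f_1(Q_p,Q_r)$, for $Q_p>0$, $Q_r>0$, be the average cost function $$f_1(Q_p,Q_r)=\frac{1}{C_3Q_p}\left(A_p+nA_r+h_1A_1+h_2A_2\right),$$ where the constants $C_1,C_2,C_3$ and the functions $n,A_1,A_2$ of $(Q_p,Q_r)$ are as defined in the context. Then the global minimum of $f_1$ over $\{(Q_p,Q_r): Q_p>0,\ Q_r>0\}$ occurs at $(Q_p^*,Q_r^* )$, where $$Q_p^*=\sqrt{\frac{2A_pD_p}{h_1+h_2pr}}$$ and $$Q_r^*=\sqrt{\frac{2\lambda C_2A_rD_r}{C_1C_2D_r(h_1+h_2)+2D_rh_2pr+\lambda C_1\left(C_1C_2h_1+4h_2pr+\frac{C_1C_2D_ph_2pr}{D_r}\right)}}.$$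
   Context: Setting (reverse logistics inventory model with one procurement batch and $n$ repair batches per cycle). $Q_p$ and $Q_r$ are the procurement and repair batch sizes (the positive real decision variables). The parameters are: $D_p$, $D_r$ the demands per unit time for new and repaired items; $p$ the collection percentage of available returns of used items; $r$ the recovery rate; $\lambda$ the repair rate per unit time; $A_p$ the fixed procurement cost; $A_r$ the fixed repair batch induction cost; $h_1$, $h_2$ the holding costs per unit per unit time at the supply and repair depots. Constants: $$C_1=1-\frac{rpD_p}{\lambda},\qquad C_2=\frac{rp}{C_1\left(1-\frac{rpD_p}{D_r}\right)},\qquad C_3=\frac{1+C_2}{D_p+D_r}.$$ Number of repair cycles (treated as a real quantity): $n=\dfrac{C_2Q_p}{Q_r}$. The cycle length is $T=C_3Q_p$. Area under the supply depot inventory curve over one cycle: $$A_1=\frac{Q_p^2}{2D_p}+\frac{C_1C_2Q_pQ_r}{2}\left[\frac{C_1}{D_r}+\frac{1}{\lambda}\right].$$ Area under the repair depot inventory curve over one cycle: $A_2=B+C'+D'+E_1+E_2$, where $$B=\frac{1}{2}rpD_p\left(\frac{C_1Q_r}{D_r}+\frac{Q_p}{D_p}\right)^2,\qquad C'=\frac{1}{2\lambda}C_1C_2Q_pQ_r,$$ $$D'=\frac{1}{2}rpD_p\left(\frac{C_2Q_p}{Q_r}-1\right)\left(\frac{C_1Q_r}{D_r}\right)^2,$$ $$E_1=Q_r\left(\frac{1}{\lambda}+\frac{C_1}{D_r}\right)\left(\frac{rpD_pC_1Q_r}{D_r}+rpQ_p-C_1Q_r\right),$$ $$E_2=Q_r^2\left(\frac{1}{\lambda}+\frac{C_1}{D_r}\right)\left(C_1-\frac{rpD_pC_1}{D_r}\right).$$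 *)

(* Defs.v *)
From Stdlib Require Import Reals.
Open Scope R_scope.

Record params : Type := Params {
  D_p : R;     (* demand per unit time for new items *)
  D_r : R;     (* demand per unit time for repaired items *)
  p_col : R;   (* p: collection percentage of available returns *)
  r_rec : R;   (* r: recovery rate *)
  lambda : R;  (* repair rate per unit time *)
  A_p : R;     (* fixed procurement cost *)
  A_r : R;     (* fixed repair batch induction cost *)
  h_1 : R;     (* unit holding cost rate, supply depot *)
  h_2 : R      (* unit holding cost rate, repair depot *)
}.

Definition C_1 (P : params) : R :=
  1 - r_rec P * p_col P * D_p P / lambda P.

Definition C_2 (P : params) : R :=
  r_rec P * p_col P / (C_1 P * (1 - r_rec P * p_col P * D_p P / D_r P)).

Definition C_3 (P : params) : R := (1 + C_2 P) / (D_p P + D_r P).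

(* The number of repair cycles, treated as a real quantity. *)
Definition repair_cycles (P : params) (Qp Qr : R) : R := C_2 P * Qp / Qr.

(* Area under the supply depot inventory curve over one cycle. *)
Definition area_supply (P : params) (Qp Qr : R) : R :=
  Qp ^ 2 / (2 * D_p P)
  + C_1 P * C_2 P * Qp * Qr / 2 * (C_1 P / D_r P + 1 / lambda P).

(* The pieces B, C', D', E_1, E_2 of the area under the repair depot
   inventory curve over one cycle. *)
Definition area_B (P : params) (Qp Qr : R) : R :=
  1 / 2 * (r_rec P * p_col P * D_p P)
  * (C_1 P * Qr / D_r P + Qp / D_p P) ^ 2.

Definition area_C (P : params) (Qp Qr : R) : R :=
  1 / (2 * lambda P) * (C_1 P * C_2 P * Qp * Qr).

Definition area_D (P : params) (Qp Qr : R) : R :=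
  1 / 2 * (r_rec P * p_col P * D_p P)
  * (C_2 P * Qp / Qr - 1) * (C_1 P * Qr / D_r P) ^ 2.

Definition area_E1 (P : params) (Qp Qr : R) : R :=
  Qr * (1 / lambda P + C_1 P / D_r P)
  * (r_rec P * p_col P * D_p P * C_1 P * Qr / D_r P
     + r_rec P * p_col P * Qp - C_1 P * Qr).

Definition area_E2 (P : params) (Qp Qr : R) : R :=
  Qr ^ 2 * (1 / lambda P + C_1 P / D_r P)
  * (C_1 P - r_rec P * p_col P * D_p P * C_1 P / D_r P).

Definition area_repair (P : params) (Qp Qr : R) : R :=
  area_B P Qp Qr + area_C P Qp Qr + area_D P Qp Qr
  + area_E1 P Qp Qr + area_E2 P Qp Qr.

(* Total cost of a cycle divided by the cycle length [C_3 P * Qp]. *)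
Definition f_1 (P : params) (Qp Qr : R) : R :=
  1 / (C_3 P * Qp)
  * (A_p P + repair_cycles P Qp Qr * A_r P
     + h_1 P * area_supply P Qp Qr + h_2 P * area_repair P Qp Qr).

Definition Qp_star (P : params) : R :=
  sqrt (2 * A_p P * D_p P / (h_1 P + h_2 P * p_col P * r_rec P)).

Definition Qr_star (P : params) : R :=
  sqrt (2 * lambda P * C_2 P * A_r P * D_r P
        / (C_1 P * C_2 P * D_r P * (h_1 P + h_2 P)
           + 2 * D_r P * h_2 P * p_col P * r_rec P
           + lambda P * C_1 P
             * (C_1 P * C_2 P * h_1 P
                + 4 * h_2 P * p_col P * r_rec P
                + C_1 P * C_2 P * D_p P * h_2 P * p_col P * r_rec P
                  / D_r P))).

(* Main.v *)
Require Import Defs.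
From Stdlib Require Import Reals Lra.
Open Scope R_scope.

(** The [Qr ^ 2] terms of the repair depot area cancel, so that

      [C_3 f_1 = (A_p / Qp + b Qp) + (C_2 A_r / Qr + G Qr)]

    with [b = (h_1 + h_2 p r) / (2 D_p)] and
    [G = Qr_denom / (2 lambda D_r)]. The two variables separate, and each
    bracket has the form [a / x + b x], minimal at [x = sqrt (a / b)]. *)

Lemma div_add_mul_min (a b x : R) :
  0 < a -> 0 < b -> 0 < x ->
  a / sqrt (a / b) + b * sqrt (a / b) <= a / x + b * x.
Proof.
intros Ha Hb Hx.
assert (Hab : 0 < a / b) by now apply Rdiv_lt_0_compat.
pose proof (sqrt_lt_R0 _ Hab) as Hs.
pose proof (sqrt_sqrt _ (Rlt_le _ _ Hab)) as Hss.
set (s := sqrt (a / b)) in *.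
(* Trading [a] for [b * (s * s)] removes the square root: the gap to the minimum becomes a rational
   expression with numerator a square times [b]. *)
assert (Ea : a = b * (s * s)) by (rewrite Hss; field; lra).
rewrite Ea.
assert (E : b * (s * s) / x + b * x - (b * (s * s) / s + b * s)
            = b * (x - s) ^ 2 / x) by (field; lra).
assert (0 <= b * (x - s) ^ 2 / x).
{ apply Rmult_le_pos.
  - apply Rmult_le_pos; [lra | apply pow2_ge_0].
  - left; now apply Rinv_0_lt_compat. }
lra.
Qed.

(** Copied term by term from the denominator under the root in [Qr_star], so that [fold] recognises
    it there. *)
Definition Qr_denom (P : params) : R :=
  C_1 P * C_2 P * D_r P * (h_1 P + h_2 P)
  + 2 * D_r P * h_2 P * p_col P * r_rec P
  + lambda P * C_1 P
    * (C_1 P * C_2 P * h_1 P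
       + 4 * h_2 P * p_col P * r_rec P
       + C_1 P * C_2 P * D_p P * h_2 P * p_col P * r_rec P / D_r P).

Lemma f_1_separable (P : params) (Qp Qr : R) :
  D_p P <> 0 -> D_r P <> 0 -> lambda P <> 0 -> C_3 P <> 0 ->
  Qp <> 0 -> Qr <> 0 ->
  f_1 P Qp Qr =
  / C_3 P *
  ((A_p P / Qp + (h_1 P + h_2 P * p_col P * r_rec P) / (2 * D_p P) * Qp)
   + (C_2 P * A_r P / Qr + Qr_denom P / (2 * lambda P * D_r P) * Qr)).
Proof.
intros.
unfold f_1, Qr_denom, repair_cycles, area_supply, area_repair, area_B, area_C,
  area_D, area_E1, area_E2.
generalize dependent (C_3 P); intros c3 Hc3.
generalize (C_1 P) (C_2 P); intros c1 c2.
field; repeat split; assumption.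
Qed.

Lemma one_sub_div_pos (k d : R) : 0 < d -> k < d -> 0 < 1 - k / d.
Proof.
intros Hd Hk.
replace (1 - k / d) with ((d - k) / d) by (field; lra).
apply Rdiv_lt_0_compat; lra.
Qed.

Theorem theorem2p1 (P : params)
  (hDp : 0 < D_p P) (hDr : 0 < D_r P) (hlambda : 0 < lambda P)
  (hAp : 0 < A_p P) (hAr : 0 < A_r P)
  (hh1 : 0 < h_1 P) (hh2 : 0 < h_2 P)
  (hp : 0 < p_col P < 1) (hr : 0 < r_rec P <= 1)
  (hlambdaDr : lambda P > D_r P)
  (hDrrpDp : D_r P > r_rec P * p_col P * D_p P) :
  0 < Qp_star P /\ 0 < Qr_star P /\
  (forall Qp Qr : R, 0 < Qp -> 0 < Qr ->
     f_1 P (Qp_star P) (Qr_star P) <= f_1 P Qp Qr).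
Proof.
destruct hp as [hp _], hr as [hr _].
(* Here [lra] chains r p D_p < D_r < lambda. *)
assert (hC1 : 0 < C_1 P) by (apply one_sub_div_pos; lra).
assert (hC2 : 0 < C_2 P).
{ apply Rdiv_lt_0_compat; [now apply Rmult_lt_0_compat |].
  apply Rmult_lt_0_compat; [assumption | apply one_sub_div_pos; lra]. }
assert (hC3 : 0 < C_3 P) by (apply Rdiv_lt_0_compat; lra).
assert (hH : 0 < h_1 P + h_2 P * p_col P * r_rec P).
{ apply Rplus_lt_0_compat; [| repeat apply Rmult_lt_0_compat]; assumption. }
assert (hG : 0 < Qr_denom P).
(* Every summand is a product of positive factors once the quotient by [D_r P] is written with an
   inverse. *)
{ unfold Qr_denom, Rdiv.
  repeat first [ assumption | apply Rplus_lt_0_compat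
               | apply Rmult_lt_0_compat | apply Rinv_0_lt_compat | lra ]. }
set (b := (h_1 P + h_2 P * p_col P * r_rec P) / (2 * D_p P)).
set (g := Qr_denom P / (2 * lambda P * D_r P)).
assert (hb : 0 < b) by (apply Rdiv_lt_0_compat; lra).
assert (hg : 0 < g).
{ apply Rdiv_lt_0_compat; [| repeat apply Rmult_lt_0_compat]; lra. }
assert (hCA : 0 < C_2 P * A_r P) by now apply Rmult_lt_0_compat.
(* Both closed forms are the points [sqrt (a / b)] of [div_add_mul_min], one for each bracket. *)
assert (EQp : Qp_star P = sqrt (A_p P / b)).
{ unfold Qp_star, b; f_equal; field; lra. }
assert (EQr : Qr_star P = sqrt (C_2 P * A_r P / g)).
{ unfold Qr_star; fold (Qr_denom P); unfold g; f_equal; field; lra. }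
assert (hQp : 0 < Qp_star P).
{ rewrite EQp; apply sqrt_lt_R0; now apply Rdiv_lt_0_compat. }
assert (hQr : 0 < Qr_star P).
{ rewrite EQr; apply sqrt_lt_R0; now apply Rdiv_lt_0_compat. }
split; [assumption | split; [assumption |]].
intros Qp Qr Hp Hr.
rewrite !f_1_separable by now apply Rgt_not_eq.
fold b g; rewrite EQp, EQr.
(* The common factor [/ C_3 P] is positive, so it suffices to compare the brackets one variable at a
   time. *)
apply Rmult_le_compat_l; [left; now apply Rinv_0_lt_compat |].
apply Rplus_le_compat; now apply div_add_mul_min.
Qed.
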